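(* Let $(A,\diamond,D,Q)$ be an admissible differential Zinbiel algebra and $q\in\mathbf{k}$. Let $(A,\cdot,D,Q)$ be its descendent admissible commutative differential algebra, $(A,\circ_q)$ the Novikov algebra induced from $(A,\cdot,D,Q)$, $a\circ_q b=a\cdot(D+qQ)(b)$, and $(A,\lhd_q,\rhd_q)$ the pre-Novikov algebra induced from $(A,\diamond,D,Q)$ by $a\lhd_q b=(D+qQ)(b)\diamond a$, $a\rhd_q b=a\diamond(D+qQ)(b)$. Then $$l_{L_\diamond,q}=L_{\rhd_q},\qquad r_{L_\diamond,q}=R_{\lhd_q},$$ where $l_{L_\diamond,q}(a)b=L_\diamond(a)(D+qQ)(b)$ and $r_{L_\diamond,q}(a)b=L_\diamond((D+qQ)(a))b$. That is, the two approaches to get the identity map $\mathrm{id}:A\to A$ as an $\mathcal{O}$-operator on the Novikov algebra $(A,\circ_q)$ coincide: on the one hand, $\mathrm{id}$ is an $\mathcal{O}$-operator on $(A,\cdot,D,Q)$ associated to $(A,L_\diamond,D,Q)$ and hence an $\mathcal{O}$-operator on $(A,\circ_q)$ associated to $(A,l_{L_\diamond,q},r_{L_\diamond,q})$; on the other hand, $(A,\circ_q)$ is the descendent Novikov algebra of $(A,\lhd_q,\rhd_q)$ and hence $\mathrm{id}$ is an $\mathcal{O}$-operator on $(A,\circ_q)$ associated to $(A,L_{\rhd_q},R_{\lhd_q})$.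
   Context: $\mathbf{k}$ is a field of characteristic $0$; all vector spaces are over $\mathbf{k}$ and finite-dimensional. For a binary operation $*$, $L_*(a)b=a*b$ and $R_*(a)b=b*a$. Zinbiel algebra $(A,\diamond)$: $a\diamond(b\diamond c)=(b\diamond a)\diamond c+(a\diamond b)\diamond c$. Admissible differential Zinbiel algebra $(A,\diamond,D,Q)$: Zinbiel algebra with linear $D,Q:A\to A$ such that $D(a\diamond b)=a\diamond D(b)+D(a)\diamond b$ and $Q(a\diamond b)=Q(a)\diamond b-a\diamond D(b)=a\diamond Q(b)-D(a)\diamond b$. Its descendent admissible commutative differential algebra is $(A,\cdot,D,Q)$ with $a\cdot b=a\diamond b+b\diamond a$. Admissible commutative differential algebra $(A,\cdot,D,Q)$: $(A,\cdot)$ commutative associative, $D$ a derivation, $Q$ linear with $Q(a\cdot b)=Q(a)\cdot b-a\cdot D(b)$. Representation $(V,l_A,\alpha,\beta)$ of it: $l_A(a\cdot b)=l_A(a)l_A(b)$, $\alpha(l_A(a)v)=l_A(D(a))v+l_A(a)\alpha(v)$, $\beta(l_A(a)v)=l_A(a)\beta(v)-l_A(D(a))v=l_A(Q(a))v-l_A(a)\alpha(v)$. An $\mathcal{O}$-operator on $(A,\cdot,D,Q)$ associated to $(V,l_A,\alpha,\beta)$: linear $T:V\to A$ with $DT=T\alpha$, $QT=T\beta$, $T(u)\cdot T(v)=T(l_A(T(u))v+l_A(T(v))u)$. Novikov algebra $(A,\circ)$: $(a\circ b)\circ c-a\circ(b\circ c)=(b\circ a)\circ c-b\circ(a\circ c)$,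 $(a\circ b)\circ c=(a\circ c)\circ b$. Representation $(V,l,r)$ of it: $l(a\circ b-b\circ a)=l(a)l(b)-l(b)l(a)$, $l(a)r(b)-r(b)l(a)=r(a\circ b)-r(b)r(a)$, $l(a\circ b)=r(b)l(a)$, $r(a)r(b)=r(b)r(a)$. An $\mathcal{O}$-operator on $(A,\circ)$ associated to $(V,l,r)$: linear $T:V\to A$ with $T(u)\circ T(v)=T(l(T(u))v)+T(r(T(v))u)$. Pre-Novikov algebra $(A,\lhd,\rhd)$: $a\rhd(b\rhd c)=(a\rhd b+a\lhd b)\rhd c+b\rhd(a\rhd c)-(b\rhd a+b\lhd a)\rhd c$; $a\rhd(b\lhd c)=(a\rhd b)\lhd c+b\lhd(a\lhd c+a\rhd c)-(b\lhd a)\lhd c$; $(a\lhd b+a\rhd b)\rhd c=(a\rhd c)\lhd b$; $(a\lhd b)\lhd c=(a\lhd c)\lhd b$. Its descendent Novikov algebra is $(A,\circ)$ with $a\circ b=a\lhd b+a\rhd b$; it is known that $(A,L_\rhd,R_\lhd)$ is a representation of $(A,\circ)$. *)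

(* Defs.v *)
From mathcomp Require Import all_boot all_algebra.

Set Implicit Arguments.
Unset Strict Implicit.
Unset Printing Implicit Defensive.

Import GRing.Theory.
Local Open Scope ring_scope.

(* A binary operation is a function A -> A -> A and a map l : A -> End(V) is its
   uncurried form A -> V -> V; in both cases bilinearity is a field of the
   structure.  Linear maps between vector spaces are elements of 'Hom(V, A). *)

Notation is_bilinear f := (bilinear_for *:%R *:%R f).

Definition Lmul (A : Type) (op : A -> A -> A) (a b : A) : A := op a b.
Definition Rmul (A : Type) (op : A -> A -> A) (a b : A) : A := op b a.

Section Structures.
Variables (k : fieldType) (A V : vectType k).

Record zinbiel (zop : A -> A -> A) : Prop := Zinbiel {
  zinbiel_bilinear : is_bilinear zop;
  zinbielA : forall a b c,
    zop a (zop b c) = zop (zop b a) c + zop (zop a b) c }.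

Record admissible_diff_zinbiel (zop : A -> A -> A) (D Q : 'End(A)) : Prop :=
  AdmissibleDiffZinbiel {
  adz_zinbiel : zinbiel zop;
  adz_derivation : forall a b, D (zop a b) = zop a (D b) + zop (D a) b;
  adz_admissiblel : forall a b, Q (zop a b) = zop (Q a) b - zop a (D b);
  adz_admissibler : forall a b, Q (zop a b) = zop a (Q b) - zop (D a) b }.

Record admissible_comm_diff (mul : A -> A -> A) (D Q : 'End(A)) : Prop :=
  AdmissibleCommDiff {
  acd_bilinear : is_bilinear mul;
  acd_mulC : forall a b, mul a b = mul b a;
  acd_mulA : forall a b c, mul (mul a b) c = mul a (mul b c);
  acd_derivation : forall a b, D (mul a b) = mul a (D b) + mul (D a) b;
  acd_admissible : forall a b, Q (mul a b) = mul (Q a) b - mul a (D b) }.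

Record acd_representation (mul : A -> A -> A) (D Q : 'End(A))
    (lA : A -> V -> V) (alpha beta : 'End(V)) : Prop := AcdRepresentation {
  acdr_algebra : admissible_comm_diff mul D Q;
  acdr_bilinear : is_bilinear lA;
  acdr_mul : forall a b v, lA (mul a b) v = lA a (lA b v);
  acdr_alpha : forall a v, alpha (lA a v) = lA (D a) v + lA a (alpha v);
  acdr_betal : forall a v, beta (lA a v) = lA a (beta v) - lA (D a) v;
  acdr_betar : forall a v, beta (lA a v) = lA (Q a) v - lA a (alpha v) }.

Record acd_O_operator (mul : A -> A -> A) (D Q : 'End(A))
    (lA : A -> V -> V) (alpha beta : 'End(V)) (T : 'Hom(V, A)) : Prop :=
  AcdOOperator {
  acdo_representation : acd_representation mul D Q lA alpha beta;
  acdo_alpha : (D \o T = T \o alpha)%VF;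
  acdo_beta : (Q \o T = T \o beta)%VF;
  acdo_mul : forall u v, mul (T u) (T v) = T (lA (T u) v + lA (T v) u) }.

Record novikov (op : A -> A -> A) : Prop := Novikov {
  novikov_bilinear : is_bilinear op;
  novikov_lsym : forall a b c,
    op (op a b) c - op a (op b c) = op (op b a) c - op b (op a c);
  novikov_rcomm : forall a b c, op (op a b) c = op (op a c) b }.

Record novikov_representation (op : A -> A -> A) (l r : A -> V -> V) : Prop :=
  NovikovRepresentation {
  novr_algebra : novikov op;
  novr_l_bilinear : is_bilinear l;
  novr_r_bilinear : is_bilinear r;
  novr_ll : forall a b v, l (op a b - op b a) v = l a (l b v) - l b (l a v);
  novr_lr : forall a b v,
    l a (r b v) - r b (l a v) = r (op a b) v - r b (r a v);
  novr_l_op : forall a b v, l (op a b) v = r b (l a v);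
  novr_rr : forall a b v, r a (r b v) = r b (r a v) }.

Record novikov_O_operator (op : A -> A -> A) (l r : A -> V -> V)
    (T : 'Hom(V, A)) : Prop := NovikovOOperator {
  novo_representation : novikov_representation op l r;
  novo_op : forall u v, op (T u) (T v) = T (l (T u) v) + T (r (T v) u) }.

Record pre_novikov (lhd rhd : A -> A -> A) : Prop := PreNovikov {
  pnov_lhd_bilinear : is_bilinear lhd;
  pnov_rhd_bilinear : is_bilinear rhd;
  pnov_rhd_rhd : forall a b c,
    rhd a (rhd b c) =
      rhd (rhd a b + lhd a b) c + rhd b (rhd a c) - rhd (rhd b a + lhd b a) c;
  pnov_rhd_lhd : forall a b c,
    rhd a (lhd b c) =
      lhd (rhd a b) c + lhd b (lhd a c + rhd a c) - lhd (lhd b a) c;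
  pnov_add_rhd : forall a b c, rhd (lhd a b + rhd a b) c = lhd (rhd a c) b;
  pnov_lhd_comm : forall a b c, lhd (lhd a b) c = lhd (lhd a c) b }.

Definition zinbiel_descendent (zop : A -> A -> A) (a b : A) : A :=
  zop a b + zop b a.

Definition pre_novikov_descendent (lhd rhd : A -> A -> A) (a b : A) : A :=
  lhd a b + rhd a b.

Definition induced_novikov (mul : A -> A -> A) (D Q : 'End(A)) (q : k)
    (a b : A) : A := mul a ((D + q *: Q) b).

Definition induced_lhd (zop : A -> A -> A) (D Q : 'End(A)) (q : k)
    (a b : A) : A := zop ((D + q *: Q) b) a.

Definition induced_rhd (zop : A -> A -> A) (D Q : 'End(A)) (q : k)
    (a b : A) : A := zop a ((D + q *: Q) b).

(* The maps l_{lA,q} and r_{lA,q} induced by (V, lA, alpha, beta); they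
   specialize to lA a ((D + q *: Q) b) and lA ((D + q *: Q) a) b for
   (V, alpha, beta) := (A, D, Q). *)
Definition induced_l (lA : A -> V -> V) (alpha beta : 'End(V)) (q : k)
    (a : A) (v : V) : V := lA a ((alpha + q *: beta) v).

Definition induced_r (D Q : 'End(A)) (lA : A -> V -> V) (q : k)
    (a : A) (v : V) : V := lA ((D + q *: Q) a) v.

End Structures.

(* Main.v *)
(** Put P = D + q Q.  The two formulas for Q (a b) give P (a b) = a (P b) +
    (1 - q) (D a) b = (P a) b + (1 - q) a (D b), while the Zinbiel identity says
    that left multiplication represents the commutative product, so that
    a (b c) = b (a c).  These facts yield the pre-Novikov identities, and for a
    pre-Novikov algebra the identity map is an O-operator on its descendent. *)
Require Import Defs.
From mathcomp Require Import all_boot all_algebra.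
From mathcomp Require Import ring.

Set Implicit Arguments.
Unset Strict Implicit.
Unset Printing Implicit Defensive.

Import GRing.Theory.
Local Open Scope ring_scope.

(** Coordinates in a basis are linear forms, and they determine the vector. *)
Lemma eq_vect_linear_forms (k : fieldType) (A : vectType k) (x y : A) :
  (forall f : {scalar A}, f x = f y) -> x = y.
Proof.
move=> eq_xy; rewrite (coord_vbasis (memvf x)) (coord_vbasis (memvf y)).
by apply: eq_bigr => i _; rewrite eq_xy.
Qed.

(* Linear forms reduce identities in a vector space to the field, where [ring]
   applies. *)
Ltac module_ring :=
  apply: eq_vect_linear_forms;
  let f := fresh "f" in move=> f;
  rewrite ?(linearD, linearB, linearN, linearZ) /=;
  ring.

Section Bilinear.
Variables (k : fieldType) (A V W : vectType k) (f : A -> V -> W).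
Hypothesis f_bilin : is_bilinear f.

Lemma bilinearDl a b v : f (a + b) v = f a v + f b v.
Proof. by have := f_bilin.1 v 1 a b; rewrite /= !scale1r. Qed.

Lemma bilinearDr a u v : f a (u + v) = f a u + f a v.
Proof. by have := f_bilin.2 a 1 u v; rewrite /= !scale1r. Qed.

Lemma bilinear0l v : f 0 v = 0.
Proof. by apply: (addrI (f 0 v)); rewrite -bilinearDl !addr0. Qed.

Lemma bilinear0r a : f a 0 = 0.
Proof. by apply: (addrI (f a 0)); rewrite -bilinearDr !addr0. Qed.

Lemma bilinearZl c a v : f (c *: a) v = c *: f a v.
Proof. by have := f_bilin.1 v c a 0; rewrite !addr0 bilinear0l addr0. Qed.

Lemma bilinearZr c a v : f a (c *: v) = c *: f a v.
Proof. by have := f_bilin.2 a c v 0; rewrite !addr0 bilinear0r addr0. Qed.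

Lemma bilinearBl a b v : f (a - b) v = f a v - f b v.
Proof. by rewrite -scaleN1r bilinearDl bilinearZl scaleN1r. Qed.

End Bilinear.

Section PreNovikov.
Variables (k : fieldType) (A : vectType k) (lhd rhd op : A -> A -> A).
(** Pointwise equality lets [op] be the induced Novikov product, whose two summands come in the
    opposite order. *)
Hypotheses (pn : pre_novikov lhd rhd)
  (opE : pre_novikov_descendent lhd rhd =2 op).

Let lhdDl := bilinearDl (pnov_lhd_bilinear pn).
Let lhdDr := bilinearDr (pnov_lhd_bilinear pn).
Let rhdDl := bilinearDl (pnov_rhd_bilinear pn).
Let rhdDr := bilinearDr (pnov_rhd_bilinear pn).
Let rhdBl := bilinearBl (pnov_rhd_bilinear pn).
Let lhdZl := bilinearZl (pnov_lhd_bilinear pn).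
Let lhdZr := bilinearZr (pnov_lhd_bilinear pn).
Let rhdZl := bilinearZl (pnov_rhd_bilinear pn).
Let rhdZr := bilinearZr (pnov_rhd_bilinear pn).

Lemma pre_novikov_descendent_novikov : novikov op.
Proof.
split.
- by split=> [b c a a' | a c b b'] /=; rewrite -!opE /pre_novikov_descendent
    ?(lhdDl, lhdDr, rhdDl, rhdDr, lhdZl, lhdZr, rhdZl, rhdZr) scalerDr addrACA.
- move=> a b c; rewrite -!opE /pre_novikov_descendent.
  (* Only [rhd a (rhd b c)] is expanded: the result contains [rhd b (rhd a c)], which cancels as it
     stands and would otherwise be expanded back. *)
  rewrite !rhdDr (pnov_rhd_rhd pn a b c) !(pnov_rhd_lhd pn _ _ c).
  rewrite ?(lhdDl, lhdDr, rhdDl, rhdDr).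
  by module_ring.
- move=> a b c; rewrite -!opE /pre_novikov_descendent !(pnov_add_rhd pn).
  by rewrite !lhdDl (pnov_lhd_comm pn a b c); module_ring.
Qed.

(** Each of the four axioms is one pre-Novikov identity with [v] as the element acted on. *)
Lemma pre_novikov_representation :
  novikov_representation op (Lmul rhd) (Rmul lhd).
Proof.
split=> [|||a b v|a b v|a b v|a b v]; rewrite /Lmul /Rmul -?opE
  /pre_novikov_descendent.
- exact: pre_novikov_descendent_novikov.
- exact: pnov_rhd_bilinear pn.
- by split=> [b c a a' | a c b b'] /=; rewrite ?(lhdDl, lhdDr, lhdZl, lhdZr).
- rewrite (pnov_rhd_rhd pn a b v) rhdBl !rhdDl.
  by module_ring.
- by rewrite (pnov_rhd_lhd pn) !lhdDr; module_ring.
- exact: pnov_add_rhd pn a b v.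
- exact: pnov_lhd_comm pn v b a.
Qed.

Lemma pre_novikov_id_O_operator :
  novikov_O_operator op (Lmul rhd) (Rmul lhd) \1%VF.
Proof.
split=> [|u v]; first exact: pre_novikov_representation.
by rewrite !id_lfunE -opE addrC.
Qed.

End PreNovikov.

Section AdmissibleDiffZinbiel.
Variables (k : fieldType) (A : vectType k) (zop : A -> A -> A) (D Q : 'End(A)).
Hypothesis adz : admissible_diff_zinbiel zop D Q.

Let zop_bilin := zinbiel_bilinear (adz_zinbiel adz).
Let zopDl := bilinearDl zop_bilin.
Let zopDr := bilinearDr zop_bilin.
Let zopZl := bilinearZl zop_bilin.
Let zopZr := bilinearZr zop_bilin.
Let mul := zinbiel_descendent zop.

Lemma zinbiel_mulE a b v : zop (mul a b) v = zop a (zop b v).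
Proof. by rewrite (zinbielA (adz_zinbiel adz)) zopDl addrC. Qed.

Lemma zinbiel_lcomm a b v : zop a (zop b v) = zop b (zop a v).
Proof. by rewrite !(zinbielA (adz_zinbiel adz)) addrC. Qed.

Lemma zinbiel_descendentA a b c : mul (mul a b) c = mul a (mul b c).
Proof.
(* The inner products stay folded so that [zinbiel_mulE] applies to them; both sides become a(bc) +
   a(cb) + b(ca). *)
rewrite {1 3}/mul /zinbiel_descendent !zinbiel_mulE /mul /zinbiel_descendent.
rewrite !zopDr (zinbiel_lcomm c a) (zinbiel_lcomm c b); module_ring.
Qed.

Lemma zinbiel_descendent_acd : admissible_comm_diff mul D Q.
Proof.
split=> [|a b|a b c|a b|a b]; rewrite ?zinbiel_descendentA //
  /mul /zinbiel_descendent.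
- by split=> [b c a a' | a c b b'] /=; rewrite zopDl zopDr zopZl zopZr scalerDr
    addrACA.
- by rewrite addrC.
- by rewrite linearD /= !(adz_derivation adz); module_ring.
(* One formula for [Q] serves each summand, so that [Q] falls on [a] and [D] on [b] in both. *)
- rewrite linearD /= (adz_admissiblel adz) (adz_admissibler adz); module_ring.
Qed.

Lemma zinbiel_id_acd_O_operator :
  acd_O_operator mul D Q (Lmul zop) D Q \1%VF.
Proof.
split; rewrite ?comp_lfun1l ?comp_lfun1r //; last first.
  by move=> u v; rewrite !id_lfunE.
split=> [||a b v|a v|a v|a v]; rewrite /Lmul.
- exact: zinbiel_descendent_acd.
- exact: zop_bilin.
- exact: zinbiel_mulE.
- by rewrite (adz_derivation adz) addrC.
- exact: adz_admissibler.
- exact: adz_admissiblel.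
Qed.

Variable q : k.
Let P : 'End(A) := D + q *: Q.

Lemma zinbiel_twistr a b : P (zop a b) = zop a (P b) + (1 - q) *: zop (D a) b.
Proof.
rewrite !add_lfunE !scale_lfunE (adz_derivation adz) (adz_admissibler adz).
by rewrite !zopDr !zopZr; module_ring.
Qed.

Lemma zinbiel_twistl a b : P (zop a b) = zop (P a) b + (1 - q) *: zop a (D b).
Proof.
rewrite !add_lfunE !scale_lfunE (adz_derivation adz) (adz_admissiblel adz).
by rewrite !zopDl !zopZl; module_ring.
Qed.

(** Equating the two expressions for [P (zop a b)] moves [P] from one factor to the other. *)
Lemma zinbiel_twist_exchange a b :
  zop (P a) b = zop a (P b) + (1 - q) *: zop (D a) b - (1 - q) *: zop a (D b).
Proof. by rewrite -zinbiel_twistr zinbiel_twistl addrK. Qed.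

Let lhd := induced_lhd zop D Q q.
Let rhd := induced_rhd zop D Q q.

Lemma zinbiel_induced_pre_novikov : pre_novikov lhd rhd.
Proof.
split=> [||a b c|a b c|a b c|a b c]; rewrite /lhd /rhd /induced_lhd
  /induced_rhd -/P.
- by split=> [b c a a' | a c b b'] /=;
    rewrite ?linearP ?zopDl ?zopDr ?zopZl ?zopZr.
- by split=> [b c a a' | a c b b'] /=;
    rewrite ?linearP ?zopDl ?zopDr ?zopZl ?zopZr.
(* [rhd a b + lhd a b] is the commutative product of [a] and [P b], so it acts as a composite of
   left multiplications. *)
- rewrite (zinbiel_mulE a) (zinbiel_mulE b) !zinbiel_twistr.
  rewrite (zinbiel_twist_exchange a) (zinbiel_twist_exchange b).
  (* Signs are absorbed into scalars so that [zopDr] and [zopZr] can distribute. *)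
  rewrite -!scaleNr ?(zopDr, zopZr) !(zinbiel_lcomm b a).
  by module_ring.
(* Expanding one summand on each side gives, for the commutative product, P(a · Pc) = a · PPc + (1 -
   q) Da · Pc, and left multiplication by each product splits. *)
- have twist_mul : zop (P (zop (P c) a + zop a (P c))) b =
      zop a (zop (P (P c)) b) + (1 - q) *: zop (D a) (zop (P c) b).
    rewrite linearD /= (zinbiel_twistr a) zinbiel_twistl -!zinbiel_mulE /mul.
    by rewrite /zinbiel_descendent !(zopDl, zopZl); module_ring.
  rewrite twist_mul zinbiel_twistl (zinbiel_twist_exchange a).
  rewrite -!scaleNr ?(zopDr, zopZr) !(zinbiel_lcomm (P c)).
  by module_ring.
- by rewrite addrC (zinbiel_mulE a) zinbiel_lcomm.
- exact: zinbiel_lcomm.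
Qed.

Lemma zinbiel_induced_descendentE :
  pre_novikov_descendent lhd rhd =2 induced_novikov mul D Q q.
Proof. by move=> a b; apply: addrC. Qed.

End AdmissibleDiffZinbiel.

Theorem proposition3p36 (k : fieldType) (k_char0 : [pchar k] =i pred0)
  (A : vectType k) (zop : A -> A -> A) (D Q : 'End(A)) (q : k)
  (zopP : admissible_diff_zinbiel zop D Q) :
  let mul := zinbiel_descendent zop in
  let circ := induced_novikov mul D Q q in
  let lhd := induced_lhd zop D Q q in
  let rhd := induced_rhd zop D Q q in
  let l := induced_l (Lmul zop) D Q q in
  let r := induced_r D Q (Lmul zop) q in
  (l =2 Lmul rhd /\ r =2 Rmul lhd) /\
  (acd_O_operator mul D Q (Lmul zop) D Q \1%VF /\
   novikov_O_operator circ l r \1%VF) /\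
  (pre_novikov lhd rhd /\
   pre_novikov_descendent lhd rhd =2 circ /\
   novikov_O_operator circ (Lmul rhd) (Rmul lhd) \1%VF).
Proof.
move=> mul circ lhd rhd l r.
have pn : pre_novikov lhd rhd := zinbiel_induced_pre_novikov zopP q.
have circE : pre_novikov_descendent lhd rhd =2 circ.
  exact: zinbiel_induced_descendentE.
have idO := pre_novikov_id_O_operator pn circE.
(* [l] and [r] are convertible to [Lmul rhd] and [Rmul lhd], so [idO] also proves the claim about
   [l] and [r]. *)
do 2?split=> //; split=> //; exact: zinbiel_id_acd_O_operator.
Qed.
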